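(* Let $G$ be either of the consolidated Tait graphs $G_B^*$ or $G_W^*$ of an oriented non-split alternating link, let $n$ be its number of vertices, let $A=A(G)$ be its ordinary ($0/1$) adjacency matrix, and write $\det(\lambda I-A)=\lambda^n+c_1\lambda^{n-1}+\cdots+c_n$. Then the following conditions are equivalent: (1) the corresponding component of $CWR_k$ (that is, $CB_k$ if $G=G_B^*$, and $CW_k$ if $G=G_W^*$) vanishes for every odd $k\ge3$; (2) $G$ contains no odd cycle; (3) $G$ is bipartite; (4) $c_{2j+1}=0$ for every $j$ for which the coefficient is defined (i.e. $1\le 2j+1\le n$); (5) the adjacency spectrum of $G$ is symmetric about zero: if $\lambda$ is an eigenvalue of $A$ with multiplicity $m$, then $-\lambda$ is also an eigenvalue of $A$ with multiplicity $m$.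
   Context: Tait graphs and $CWR$. Let $D$ be a reduced (no nugatory crossings) alternating diagram of an oriented non-split alternating link $L$. The regions of $D$ are checkerboard coloured black and white, so that regions sharing an edge have opposite colours; which class is called black is fixed once and for all by a local rule depending on the over/under pattern at crossings, the same rule for all diagrams (the statement holds for either choice of rule). The Tait graph $G_B$ has one vertex for each black region and one edge for each crossing, joining the black regions meeting at that crossing; $G_W$ is defined in the same way from white regions. Each edge $e$ gets weight $\operatorname{wg}(e)=w$ if the crossing is positive and $r$ if it is negative, where $w,r$ are commuting indeterminates. The consolidated Tait graph $G_B^*$ is the weighted simple graph obtained from $G_B$ by replacing all parallel edges joining the same pair of vertices by a single edge whose weight is the product of their weights (so every edge weight is a monomial in $w,r$); $G_W^*$ is obtained from $G_W$ likewise. For $i>2$, $CB_i(w,r)=\sum_C\prod_{e\in E(C)}\operatorname{wg}(e)$, summed over all unoriented simple cycles $C$ of length $i$ in $G_B^*$ (zero if there are none); $CW_i$ is defined analogously from $G_W^*$; and $CWR_i=(CB_i,CW_i)$. *)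

(* Defs.v *)
From HB Require Import structures.
From mathcomp Require Import all_boot all_order all_fingroup all_algebra.
From mathcomp Require Import mpoly.

Set Implicit Arguments.
Unset Strict Implicit.
Unset Printing Implicit Defensive.

Import GRing.Theory.
Local Open Scope ring_scope.

(** * Oriented link diagrams on the sphere, as combinatorial maps

  The four half-edges ("darts") at a crossing c are (c, 0), (c, 1), (c, 2),
  (c, 3), listed counterclockwise; (c, 0) and (c, 2) lie on the understrand,
  (c, 1) and (c, 3) on the overstrand.  [glue] pairs the two ends of every arc
  running between crossings.  A component without crossings (as in the
  standard diagram of the unknot) is an element l of [circle]; it is given a
  base point, from which the two darts (l, true) and (l, false) issue. *)

Record precode := PreCode {
  crossing : finType;
  circle : finType;
  glue : crossing * 'Z_4 -> crossing * 'Z_4;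
  glueK : involutive glue
}.

Section CombinatorialMap.
Variable D : precode.

Definition dart : finType := ((crossing D * 'Z_4) + (circle D * bool))%type.

Definition edge_fun (d : dart) : dart :=
  match d with
  | inl x => inl (glue x)
  | inr (l, b) => inr (l, ~~ b)
  end.

Definition node_fun (d : dart) : dart :=
  match d with
  | inl (c, i) => inl (c, i + 1)
  | inr (l, b) => inr (l, ~~ b)
  end.

Lemma edge_fun_inj : injective edge_fun.
Proof.
apply: (@inv_inj _ edge_fun) => -[x|[l b]] /=; first by rewrite glueK.
by rewrite negbK.
Qed.

Lemma node_fun_inj : injective node_fun.
Proof.
move=> [[c i]|[l b]] [[c' i']|[l' b']] //= [-> e]; last by rewrite (negb_inj e).
by congr (inl (_, _)); apply: (addIr 1); apply: val_inj.
Qed.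

Definition edge : {perm dart} := perm edge_fun_inj.
Definition node : {perm dart} := perm node_fun_inj.

(* Permutations compose from left to right: [face d = node (edge d)].  Its
   orbits are the regions; the orbit of d is the region on the right-hand side
   of d for an observer leaving the vertex along d.  At a crossing c, this is
   the region occupying the corner between (c, i - 1) and (c, i) if
   d = (c, i). *)
Definition face : {perm dart} := (edge * node)%g.

Definition linked : rel dart := [rel x y | (y == edge x) || (y == node x)].

Definition components : nat := n_comp linked predT.

(* Euler's formula V - E + F = 2 on each connected component. *)
Definition planar : Prop :=
  (#|porbits node| + #|porbits face| = #|porbits edge| + components.*2)%N.

(* [o d] means that the link is oriented away from the vertex of d along d. *)
Definition orientation (o : dart -> bool) : Prop :=
  (forall d, o (edge d) = ~~ o d) /\
  (forall c i, o (inl (c, i + 2%:R)) = ~~ o (inl (c, i))).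

End CombinatorialMap.

Record diagram := Diagram {
  code :> precode;
  code_planar : planar code;
  outward : dart code -> bool;
  outward_orientation : orientation outward
}.

Section Diagram.
Variable D : diagram.

(* A diagram of a non-split link is connected; conversely, by a theorem of
   Menasco, a connected alternating diagram represents a non-split link. *)
Definition connected_diagram : Prop := components D = 1%N.

Definition over (x : crossing D * 'Z_4) : bool := odd x.2.

Definition alternating : Prop := forall x, over (glue x) = ~~ over x.

Definition region : finType := {R : {set dart D} | R \in porbits (face D)}.

Lemma mem_porbits (d : dart D) : porbit (face D) d \in porbits (face D).
Proof. exact: imset_f. Qed.

Definition region_of (d : dart D) : region :=
  exist (fun R => R \in porbits (face D)) _ (mem_porbits d).

(* The region at the i-th corner of c, see [face]. *)
Definition corner (c : crossing D) (i : 'Z_4) : region := region_of (inl (c, i)).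

(* A closed curve meeting the diagram in the single crossing c leaves c through
   two opposite corners, which thus belong to the same region. *)
Definition nugatory (c : crossing D) : Prop :=
  exists i, corner c i = corner c (i + 2%:R).

Definition reduced : Prop := forall c, ~ nugatory c.

(* Right-handed crossing: a quarter turn counterclockwise takes the direction
   of the overstrand to that of the understrand. *)
Definition positive (c : crossing D) : bool :=
  outward (inl (c, 1)) == outward (inl (c, 2%:R)).

(* Checkerboard colouring: [black R] says that R is black.  The two sides of an
   arc have opposite colours, and the colours at the crossings are given by the
   local rule [rule]: the corners swept by turning the overstrand
   counterclockwise up to the understrand are (c, 0) and (c, 2); they are
   white if [rule] is [false], and black if [rule] is [true].  In the absence
   of crossings, the rule does not say which class is black. *)
Definition checkerboard (rule : bool) (black : region -> bool) : Prop :=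
  (forall d, black (region_of (edge D d)) = ~~ black (region_of d)) /\
  (forall c i, black (corner c i) = rule (+) odd i).

End Diagram.

Notation wr_poly := {mpoly int[2]}.
Definition w_ : wr_poly := 'X_(0 : 'I_2).
Definition r_ : wr_poly := 'X_(1 : 'I_2).

Record wmultigraph := WMultigraph {
  mvertex : finType;
  medge : finType;
  ends : medge -> {set mvertex};
  wg : medge -> wr_poly
}.

(* An edge is identified with the set of its ends; [weight] is only meaningful
   on [edges]. *)
Record wgraph := WGraph {
  vertex : finType;
  edges : {set {set vertex}};
  weight : {set vertex} -> wr_poly
}.

Definition consolidate (M : wmultigraph) : wgraph :=
  WGraph [set ends e | e : medge M]
         (fun s => \prod_(e : medge M | ends e == s) wg e).

Section Graph.
Variable G : wgraph.

Definition adj : rel (vertex G) := [rel x y | [set x; y] \in edges G].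

Definition cycle_edges (p : seq (vertex G)) : {set {set vertex G}} :=
  [set [set x; next p x] | x in p].

(* An unoriented simple cycle is identified with its set of edges. *)
Definition simple_cycle (k : nat) (C : {set {set vertex G}}) : bool :=
  (2 < k)%N &&
  [exists p : k.-tuple (vertex G), ucycleb adj p && (C == cycle_edges p)].

Definition cycle_poly (k : nat) : wr_poly :=
  \sum_(C : {set {set vertex G}} | simple_cycle k C) \prod_(e in C) weight e.

Definition bipartite : Prop :=
  exists f : vertex G -> bool, forall x y, adj x y -> f x != f y.

Definition adjacency_matrix (F : nzRingType) : 'M[F]_#|vertex G| :=
  \matrix_(i, j) (adj (enum_val i) (enum_val j))%:R.

End Graph.

(* [char_poly A] is det ('X - A); c_i is its coefficient of 'X^(n - i). *)
Definition char_coef (F : comNzRingType) n (A : 'M[F]_n) (i : nat) : F :=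
  (char_poly A)`_(n - i)%N.

(* The multiplicity is that of a as a root of the characteristic polynomial. *)
Definition eigenvalue_mult (F : fieldType) n (A : 'M[F]_n) (a : F) (m : nat) :=
  eigenvalue A a /\ mup a (char_poly A) = m.

Definition tait (D : diagram) (P : pred (region D)) : wmultigraph :=
  @WMultigraph {R : region D | P R} (crossing D)
    (fun c => [set v | [exists i, val v == corner c i]])
    (fun c => if positive c then w_ else r_).

Definition GB (D : diagram) (black : region D -> bool) : wmultigraph :=
  tait black.
Definition GW (D : diagram) (black : region D -> bool) : wmultigraph :=
  tait (fun R => ~~ black R).

Definition GBstar D (black : region D -> bool) := consolidate (GB black).
Definition GWstar D (black : region D -> bool) := consolidate (GW black).

Definition CB D (black : region D -> bool) k := cycle_poly (GBstar black) k.
Definition CW D (black : region D -> bool) k := cycle_poly (GWstar black) k.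
Definition CWR D (black : region D -> bool) k := (CB black k, CW black k).

Inductive side := Black | White.

Definition Gstar D (black : region D -> bool) (s : side) : wgraph :=
  match s with Black => GBstar black | White => GWstar black end.

Definition component T (s : side) (p : T * T) : T :=
  match s with Black => p.1 | White => p.2 end.

(* Main.v *)
(** A simple cycle contributes a monomial with coefficient 1 to [cycle_poly],
  so nothing cancels: evaluating at w = r = 1 counts the cycles.  If G is
  bipartite, conjugating A by the diagonal matrix of signs of a 2-colouring
  gives -A, so that the characteristic polynomial p satisfies
  p(-X) = (-1)^n p(X), which makes the odd c_i vanish and the roots symmetric.
  Conversely, if the roots are symmetric, then so is the spectrum in the
  diagonalization of the symmetric matrix A, whence tr A^k = 0 for k odd; since
  A has nonnegative entries, there is no closed walk of odd length. *)
Require Import Defs.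
From HB Require Import structures.
From mathcomp Require Import all_boot all_order all_fingroup all_algebra.
From mathcomp Require Import mpoly zify.

Set Implicit Arguments.
Unset Strict Implicit.
Unset Printing Implicit Defensive.

Import Order.TTheory GRing.Theory Num.Theory.
Local Open Scope ring_scope.

(** * Odd closed walks, odd cycles and 2-colourings *)

Section OddCycles.

Lemma not_uniq_split (T : eqType) (s : seq T) :
  ~~ uniq s -> exists x s1 s2 s3, s = s1 ++ x :: s2 ++ x :: s3.
Proof.
elim: s => //= y s IHs; rewrite negb_and negbK => /orP[/splitPr[s1 s2]|].
  by exists y, [::], s1, s2.
by move=> /IHs[x [s1 [s2 [s3 ->]]]]; exists x, (y :: s1), s2, s3.
Qed.

Lemma cycle_cut (T : eqType) (e : rel T) (x : T) (s1 s2 s3 : seq T) :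
  path.cycle e (s1 ++ x :: s2 ++ x :: s3) ->
  path.cycle e (x :: s2) /\ path.cycle e (x :: s3 ++ s1).
Proof.
(* Rotating by [size s1] puts [x] first, so both pieces are closed walks based at [x]. *)
rewrite -(rot_cycle (size s1)) rot_size_cat /=.
by rewrite -!cats1 -!catA cat_path /= !cat_path /= => /and4P[-> -> -> ->].
Qed.

(** Strong induction on the length: a repeated vertex cuts the walk into two shorter closed walks,
    one of which is odd. Without repetition, irreflexivity excludes length 1. *)
Lemma odd_ucycle (T : eqType) (e : rel T) (p : seq T) :
  irreflexive e -> path.cycle e p -> odd (size p) ->
  exists q, [/\ ucycle e q, odd (size q) & (2 < size q)%N].
Proof.
move=> e_irr; have [m le_pm] := ubnP (size p).
elim: m p le_pm => // m IHm p le_pm e_p odd_p.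
have [p_uniq|/not_uniq_split[x [s1 [s2 [s3 def_p]]]]] := boolP (uniq p).
  exists p; rewrite /ucycle /ucycleb e_p p_uniq; split=> //.
  case: p odd_p e_p {le_pm p_uniq} => [|x [|y [|z p]]] //= _.
  by rewrite e_irr.
move: le_pm e_p odd_p; rewrite {p}def_p ltnS => le_pm /cycle_cut[e_2 e_31].
have ->: size (s1 ++ x :: s2 ++ x :: s3)
         = (size (x :: s2) + size (x :: s3 ++ s1))%N.
  by rewrite !size_cat /= !size_cat /=; lia.
rewrite oddD; case odd_2: (odd _) => odd_31.
  apply: IHm e_2 odd_2; apply: leq_trans le_pm.
  by rewrite !size_cat /= !size_cat /=; lia.
apply: IHm e_31 odd_31; apply: leq_trans le_pm.
by rewrite !size_cat /= !size_cat /=; lia.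
Qed.

(** The colour of a vertex is the parity of a chosen walk to the root of its component. If adjacent
    [x] and [y] had equal colours, going from [x] to the root, back to [y] and along the edge to [x]
    would be an odd closed walk. *)
Lemma two_colouring (T : finType) (e : rel T) :
  ssrbool.symmetric e -> (forall p, path.cycle e p -> ~~ odd (size p)) ->
  exists f : T -> bool, forall x y, e x y -> f x != f y.
Proof.
move=> e_sym even_cycle.
have walk x : {p : seq T | path e x p && (last x p == fingraph.root e x)}.
  apply/sigW; have /connectP[p e_p ->] := connect_root e x.
  by exists p; rewrite e_p eqxx.
exists (fun x => odd (size (sval (walk x)))) => x y e_xy; apply/negP => /eqP.
case: (walk x) (walk y) => [p /= /andP[e_p /eqP lp]] [q /= /andP[e_q /eqP lq]].
have eq_root : fingraph.root e x = fingraph.root e y.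
  by apply/eqP; rewrite root_connect ?connect1 //; apply: sym_connect_sym.
have last_rev : last (last y q) (rev (belast y q)) = y.
  by case: (q) => //= z q'; rewrite rev_cons last_rcons.
have e_rev : path e (last y q) (rev (belast y q)).
  by rewrite rev_path (@eq_path _ _ e) // => u v; apply: e_sym.
have := even_cycle (x :: p ++ rev (belast y q)).
rewrite /= rcons_cat cat_path e_p rcons_path lp eq_root -lq e_rev last_rev.
rewrite e_sym e_xy size_cat size_rev size_belast oddD => /(_ isT) odd_pq eq_pq.
by rewrite eq_pq addbb in odd_pq.
Qed.

End OddCycles.

(** * Characteristic polynomials and spectra symmetric about zero *)

Section CharPoly.

Lemma coef_comp_polyNX (R : comNzRingType) (p : {poly R}) i :
  (p \Po - 'X)`_i = (-1) ^+ i * p`_i.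
Proof.
rewrite comp_polyE coef_sum.
under eq_bigr => j _ do
  rewrite coefZ -[- 'X]mulN1r -polyCN exprMn -polyC_exp coefCM coefXn.
have [lt_ip|le_pi] := ltnP i (size p); last first.
  rewrite (nth_default _ le_pi) mulr0 big1 // => j _.
  by rewrite gtn_eqF ?mulr0 // (leq_trans (ltn_ord j)).
rewrite (bigD1 (Ordinal lt_ip)) //= eqxx mulr1 mulrC big1 ?addr0 // => j.
by rewrite -val_eqE /= eq_sym => /negPf->; rewrite !mulr0.
Qed.

Lemma char_polyN (R : comNzRingType) n (A : 'M[R]_n) :
  char_poly (- A) = (-1) ^+ n * (char_poly A \Po - 'X).
Proof.
rewrite /char_poly -det_map_mx -detZ; congr (\det _).
apply/matrixP => i j; rewrite !mxE rmorphB rmorphMn /= comp_polyX comp_polyC.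
by rewrite polyCN mulN1r opprB opprK mulNrn opprK addrC.
Qed.

(** The relation passes to the characteristic matrices; in their determinants the nonzero constant
    [\det Q] cancels. *)
Lemma char_poly_similar (F : fieldType) n (P A B : 'M[F]_n) :
  P \in unitmx -> P *m A = B *m P -> char_poly A = char_poly B.
Proof.
move=> P_unit PA_BP; pose Q := map_mx (@polyC F) P.
have detQ : \det Q != 0.
  by rewrite det_map_mx polyC_eq0 -unitfE -unitmxE.
apply: (mulfI detQ); rewrite [RHS]mulrC /char_poly -!det_mulmx; congr (\det _).
by rewrite mulmxBr mulmxBl -!map_mxM PA_BP scalar_mxC.
Qed.

(** Comparing coefficients gives c_i = (-1)^i c_i, which for odd i means c_i = 0 in characteristic
    zero. *)
Lemma char_poly_parity (F : numFieldType) n (A : 'M[F]_n) :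
  char_poly A = (-1) ^+ n * (char_poly A \Po - 'X) <->
  forall j, (1 <= 2 * j + 1 <= n)%N -> char_coef A (2 * j + 1)%N = 0.
Proof.
have coefE i : (i <= n)%N ->
    ((-1) ^+ n * (char_poly A \Po - 'X))`_(n - i) = (-1) ^+ i * char_coef A i.
  move=> le_in; rewrite -polyCN -polyC_exp coefCM coef_comp_polyNX mulrA -exprD.
  by congr (_ * _); rewrite -[LHS]signr_odd oddD oddB // addbA addbb signr_odd.
split=> [p_par j /andP[_ le_jn]|c0].
  have /eqP := coefE _ le_jn; rewrite -p_par -/(char_coef A _).
  rewrite -signr_odd oddD oddM /= expr1 mulN1r -addr_eq0 -mulr2n.
  by rewrite mulrn_eq0 => /eqP.
apply/polyP => i; have [le_in|lt_ni] := leqP i n; last first.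
  rewrite -polyCN -polyC_exp coefCM coef_comp_polyNX.
  by rewrite nth_default ?mulr0 // size_char_poly.
rewrite -(subKn le_in) coefE ?leq_subr // -/(char_coef A _).
have [odd_ni|even_ni] := boolP (odd (n - i)); last first.
  by rewrite -signr_odd (negPf even_ni) mul1r.
suff -> : char_coef A (n - i) = 0 by rewrite mulr0.
have -> : (n - i = 2 * (n - i)./2 + 1)%N by lia.
by apply: c0; lia.
Qed.

(** Once the polynomial splits, multiplicities are numbers of occurrences in [s]. *)
Lemma eigenvalue_mult_sym_count (F : fieldType) n (A : 'M[F]_n) (s : seq F) :
  char_poly A = \prod_(y <- s) ('X - y%:P) ->
  (forall a m, eigenvalue_mult A a m -> eigenvalue_mult A (- a) m) <->
  perm_eq s (map -%R s).
Proof.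
move=> def_p.
have countN a : count_mem a (map -%R s) = count_mem (- a) s.
  by rewrite count_map; apply: eq_count => y /=; rewrite eqr_oppLR.
have multE a m : eigenvalue_mult A a m <-> a \in s /\ count_mem a s = m.
  rewrite /eigenvalue_mult eigenvalue_root_char def_p.
  by rewrite root_prod_XsubC mu_prod_XsubC.
split=> [sym|/seq.permP s_sym a m /multE[sa <-]].
  have symE a : a \in s -> count_mem (- a) s = count_mem a s.
    by move=> sa; have /multE[] : eigenvalue_mult A (- a) (count_mem a s)
      by apply/sym/multE.
  apply/allP => a _ /=; rewrite countN; apply/eqP.
  (* The hypothesis [sym] speaks of eigenvalues only, so it is applied to [a] or to [- a], whichever
     is in [s]; if neither is, both counts are 0. *)
  have [sa|s'a] := boolP (a \in s); first by rewrite symE.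
  have [sNa|s'Na] := boolP (- a \in s); first by rewrite -[in LHS](opprK a) symE.
  by rewrite !(count_memPn _).
have eq_count := s_sym (pred1 a); rewrite countN in eq_count.
apply/multE; split; last by [].
by rewrite -has_pred1 has_count -eq_count -has_count has_pred1.
Qed.

Lemma prod_XsubC_opp (R : comNzRingType) (s : seq R) :
  (-1) ^+ size s * ((\prod_(y <- s) ('X - y%:P)) \Po - 'X)
  = \prod_(y <- map -%R s) ('X - y%:P).
Proof.
rewrite big_map rmorph_prod /=.
elim: s => [|y s IHs]; first by rewrite !big_nil mulr1.
rewrite !big_cons /= exprS mulrACA IHs rmorphB /= comp_polyX comp_polyC.
by rewrite mulN1r opprD !opprK polyCN opprK.
Qed.

(** Over a closed field the polynomial splits, and the substitution of [- 'X], up to sign, negates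
    every root. *)
Lemma coef_odd_eigenvalue_sym (F : numClosedFieldType) n (A : 'M[F]_n) :
  (forall j, (1 <= 2 * j + 1 <= n)%N -> char_coef A (2 * j + 1)%N = 0) ->
  forall a m, eigenvalue_mult A a m -> eigenvalue_mult A (- a) m.
Proof.
move=> /char_poly_parity p_par.
have [s def_p] := closed_field_poly_normal (char_poly A).
rewrite (monicP (char_poly_monic A)) scale1r in def_p.
apply/(eigenvalue_mult_sym_count def_p).
have sz_s : size s = n.
  by have := size_char_poly A; rewrite def_p size_prod_XsubC => -[].
have eq_prod : \prod_(y <- s) ('X - y%:P) = \prod_(y <- map -%R s) ('X - y%:P).
  by rewrite -prod_XsubC_opp sz_s -def_p.
by apply/allP => a _ /=; rewrite -!mu_prod_XsubC eq_prod.
Qed.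

Lemma trace_exp_sym (F : numClosedFieldType) n (A : 'M[F]_n) k :
  A \is normalmx ->
  (forall a m, eigenvalue_mult A a m -> eigenvalue_mult A (- a) m) ->
  odd k -> \tr (A ^+ k) = 0.
Proof.
move=> /orthomx_spectralP; set P := spectralmx A; set d := spectral_diag A.
move=> defA sym odd_k; have P_unit : P \in unitmx := spectral_unit A.
have PA : P *m A = diag_mx d *m P.
  by rewrite [in LHS]defA !mulmxA mulmxV // mul1mx.
have PAk : P *m A ^+ k = diag_mx d ^+ k *m P.
  elim: k {odd_k} => [|k IHk]; first by rewrite mulmx1 mul1mx.
  by rewrite exprSr -mulmxE mulmxA IHk -mulmxA PA mulmxA mulmxE -exprSr.
have dkE : diag_mx d ^+ k = diag_mx (\row_i d 0 i ^+ k).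
  elim: k {odd_k PAk} => [|k IHk].
    by apply/matrixP => i j; rewrite !mxE expr0.
  rewrite exprS IHk -mulmxE mulmx_diag; congr diag_mx.
  by apply/rowP=> i; rewrite !mxE exprS.
have -> : \tr (A ^+ k) = \sum_i d 0 i ^+ k.
  rewrite -[A ^+ k](mulKmx P_unit) PAk mxtrace_mulC mulmxK // dkE mxtrace_diag.
  by apply: eq_bigr => i _; rewrite mxE.
pose s := [seq d 0 i | i <- index_enum 'I_n].
have def_p : char_poly A = \prod_(y <- s) ('X - y%:P).
  rewrite (char_poly_similar P_unit PA) char_poly_trig ?diag_mx_is_trig //.
  by rewrite big_map; apply: eq_bigr => i _; rewrite mxE eqxx.
have /(eigenvalue_mult_sym_count def_p) perm_s := sym.
have sumE : \sum_i d 0 i ^+ k = \sum_(y <- s) y ^+ k by rewrite big_map.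
(* One of two copies of the power sum is reindexed by negation; as k is odd, it cancels the
   other. *)
apply/eqP; suff : (\sum_i d 0 i ^+ k) *+ 2 == 0 by rewrite mulrn_eq0.
rewrite mulr2n {1}sumE (perm_big _ perm_s) /= big_map.
rewrite sumE -big_split /= big1 // => y _.
by rewrite exprNn -signr_odd odd_k mulN1r addNr.
Qed.

End CharPoly.

(** * Closed walks, cycles and the adjacency matrix of a weighted graph *)

Section SimpleGraph.
Variables (G : wgraph) (F : numClosedFieldType).
Local Notation A := (adjacency_matrix G F).

Lemma adj_sym : ssrbool.symmetric (@adj G).
Proof. by move=> x y; rewrite /adj /= setUC. Qed.

Lemma adjacency_normal : A \is normalmx.
Proof.
apply: symmetric_normalmx.
  apply/is_hermitianmxP; rewrite expr0 scale1r; apply/matrixP => i j.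
  by rewrite !mxE adj_sym.
by apply/mxOverP => i j; rewrite mxE realn.
Qed.

Lemma adjacency_exp_ge0 k i j : 0 <= (A ^+ k) i j.
Proof.
elim: k i j => [|k IHk] i j; first by rewrite mxE; case: eqP.
rewrite exprS mxE; apply: sumr_ge0 => l _; rewrite mulr_ge0 //.
by rewrite mxE ler0n.
Qed.

(** The walk contributes a positive term to the entry, and all other terms are nonnegative. *)
Lemma walk_adjacency_exp x p : path (@adj G) x p ->
  0 < (A ^+ size p) (enum_rank x) (enum_rank (last x p)).
Proof.
elim: p x => [|y p IHp] x /=; first by rewrite mxE eqxx ltr01.
move=> /andP[xy /IHp yp]; rewrite exprS mxE (bigD1 (enum_rank y)) //=.
apply: ltr_wpDr; last by rewrite mxE !enum_rankK xy mul1r.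
apply: sumr_ge0 => l _; rewrite mulr_ge0 ?adjacency_exp_ge0 //.
by rewrite mxE ler0n.
Qed.

(** A closed walk would make a diagonal entry positive. The bound on [k] excludes the empty
    sequence, which counts as a [path.cycle]. *)
Lemma no_closed_walk k p :
  \tr (A ^+ k) = 0 -> size p = k -> (0 < k)%N -> ~~ path.cycle (@adj G) p.
Proof.
move=> tr0 sz_p k_gt0; apply/negP; case: p sz_p => [|x p] /= sz_p.
  by rewrite -sz_p in k_gt0.
move=> /walk_adjacency_exp; rewrite size_rcons last_rcons sz_p => pos.
suff : 0 < \tr (A ^+ k) by rewrite tr0 ltxx.
rewrite /mxtrace (bigD1 (enum_rank x)) //=.
by apply: ltr_wpDr => //; apply: sumr_ge0 => i _; apply: adjacency_exp_ge0.
Qed.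

Lemma eigenvalue_sym_cycle_poly k :
  (forall a m, eigenvalue_mult A a m -> eigenvalue_mult A (- a) m) ->
  odd k -> cycle_poly G k = 0.
Proof.
move=> sym odd_k; rewrite /cycle_poly big_pred0 // => C.
apply/negP => /andP[_ /existsP[p /andP[/andP[e_p _] _]]].
have := no_closed_walk (trace_exp_sym adjacency_normal sym odd_k) (size_tuple p).
by rewrite e_p odd_gt0 // => /(_ isT).
Qed.

Lemma bipartite_char_coef : bipartite G ->
  forall j, (1 <= 2 * j + 1 <= #|vertex G|)%N -> char_coef A (2 * j + 1)%N = 0.
Proof.
case=> f f_col; apply/char_poly_parity; rewrite -char_polyN.
pose S : 'M[F]_#|vertex G| := diag_mx (\row_i (-1) ^+ f (enum_val i)).
have S_unit : S \in unitmx.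
  rewrite unitmxE det_diag unitr_prod // => i _.
  by rewrite mxE unitrX // unitrN1.
apply: (char_poly_similar S_unit); apply/matrixP => i j.
rewrite mul_diag_mx mul_mx_diag !mxE.
(* Adjacent vertices carry opposite signs, so [S] anticommutes with the adjacency matrix. *)
have [/f_col|_] := boolP (adj _ _); last by rewrite oppr0 mulr0 mul0r.
by case: (f _) (f _) => -[] //= _; rewrite !(mulr1, mulN1r, opprK).
Qed.

Hypothesis weight1 : forall e, (weight (w := G) e).@[fun=> 1] = 1.

Lemma cycle_poly_eval1 k :
  (cycle_poly G k).@[fun=> 1] = #|[pred C | simple_cycle (G := G) k C]|%:R.
Proof.
rewrite /cycle_poly rmorph_sum /= -sumr_const; apply: eq_bigr => C _.
by rewrite rmorph_prod big1 // => e _; apply: weight1.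
Qed.

Lemma cycle_poly0 k C : cycle_poly G k = 0 -> ~~ simple_cycle (G := G) k C.
Proof.
move=> p0; have /esym/eqP := cycle_poly_eval1 k.
by rewrite p0 meval0 pnatr_eq0 => /eqP/card0_eq/(_ C)/negbT.
Qed.

(** A loop is an odd closed walk that [simple_cycle], starting at length 3, does not see. *)
Hypothesis adj_irr : irreflexive (@adj G).

Lemma no_odd_cycle_bipartite :
  ~ (exists k C, odd k /\ simple_cycle (G := G) k C) -> bipartite G.
Proof.
move=> no_odd; apply: two_colouring adj_sym _ => p e_p; apply/negP => odd_p.
have [q [u_q odd_q q_gt2]] := odd_ucycle adj_irr e_p odd_p.
case: no_odd; exists (size q), (cycle_edges q); split=> //.
by rewrite /simple_cycle q_gt2; apply/existsP; exists (in_tuple q); apply/andP.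
Qed.

Lemma odd_cycle_tfae :
  [<->
    forall k, odd k -> (3 <= k)%N -> cycle_poly G k = 0;
    ~ (exists k C, odd k /\ simple_cycle (G := G) k C);
    bipartite G;
    forall j, (1 <= 2 * j + 1 <= #|vertex G|)%N ->
      char_coef A (2 * j + 1)%N = 0;
    forall a m, eigenvalue_mult A a m -> eigenvalue_mult A (- a) m
  ].
Proof.
tfae.
- move=> p0 [k [C [odd_k C_cycle]]]; have [k_gt2 _] := andP C_cycle.
  by have /negP[] := cycle_poly0 C (p0 k odd_k k_gt2).
- exact: no_odd_cycle_bipartite.
- exact: bipartite_char_coef.
- exact: coef_odd_eigenvalue_sym.
- by move=> sym k odd_k _; apply: eigenvalue_sym_cycle_poly.
Qed.

End SimpleGraph.

(** * Consolidated Tait graphs of reduced diagrams *)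

Section Tait.
Variables (D : diagram) (P : pred (region D)).

(** Weights are products of [w_] and [r_]; outside the edges the product is empty. *)
Lemma tait_weight1 e :
  (weight (w := consolidate (tait P)) e).@[fun=> 1] = 1.
Proof.
rewrite rmorph_prod big1 // => c _ /=.
by case: positive; rewrite mevalXU.
Qed.

(** At a loop, two opposite corners of a crossing are the same region, so the crossing is
    nugatory. *)
Lemma tait_adj_irr : reduced D ->
  (forall c, exists i, P (corner c i) && P (corner c (i + 2%:R))) ->
  irreflexive (@adj (consolidate (tait P))).
Proof.
move=> Dred P_corner x; apply/negP => /imsetP[c _]; rewrite setUid => def_x.
have [i /andP[Pi Pi2]] := P_corner c.
have cornerx j : P (corner c j) -> corner c j = val x.
  move=> Pj; have : Sub (corner c j) Pj \in [set x].
    by rewrite def_x inE; apply/existsP; exists j.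
  by rewrite inE => /eqP <-; rewrite SubK.
by case: (Dred c); exists i; rewrite (cornerx i Pi) (cornerx _ Pi2).
Qed.

End Tait.

Theorem proposition7p1
  (D : diagram) (Dconn : connected_diagram D) (Dalt : alternating D)
  (Dred : reduced D)
  (rule : bool) (black : region D -> bool) (Dblack : checkerboard rule black)
  (s : side) (F : numClosedFieldType) :
  let G := Gstar black s in
  let n := #|vertex G| in
  let A := adjacency_matrix G F in
  [<->
    forall k, odd k -> (3 <= k)%N -> component s (CWR black k) = 0;
    ~ (exists k C, odd k /\ @simple_cycle G k C);
    bipartite G;
    forall j, (1 <= 2 * j + 1 <= n)%N -> char_coef A (2 * j + 1)%N = 0;
    forall a m, eigenvalue_mult A a m -> eigenvalue_mult A (- a) m
  ].
Proof.
have [_ black_corner] := Dblack.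
have tfae_tait P P_corner :=
  odd_cycle_tfae F (@tait_weight1 D P) (tait_adj_irr Dred P_corner).
case: s; apply: tfae_tait => c.
(* The black corners are 0 and 2 if [rule] is [true], and 1 and 3 otherwise; the white ones are the
   other two. *)
- by exists (if rule then 0 else 1); rewrite !black_corner; case: (rule).
- by exists (if rule then 1 else 0); rewrite !black_corner; case: (rule).
Qed.
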